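(* Let $\theta^*\in(0.25,0.75)$ and let $Y_1,Y_2,\dots$ be i.i.d. $\mathrm{Ber}(\theta^* )$, so that $\boldsymbol{Y}^{(n)}=(Y_1,\dots,Y_n)$ has law $\mathrm{Ber}(\theta^* )^{\otimes n}$. Consider the Bayesian model in which $Y_1,\dots,Y_n\mid\theta$ are i.i.d. $\mathrm{Ber}(\theta)$ and $\theta\sim\mathrm{Unif}(0,1)$, with normalizing constant $\pi(\boldsymbol{Y}^{(n)})$ and Laplace approximation $\widetilde\pi_{\mathrm{LA}}(\boldsymbol{Y}^{(n)})$ as defined in the context. Then, almost surely, there exists $N_0$ such that for all $n>N_0$, $$\left|\frac{\pi(\boldsymbol{Y}^{(n)})}{\widetilde\pi_{\mathrm{LA}}(\boldsymbol{Y}^{(n)})}-1\right|\ge\frac{1}{26n}.$$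
   Context: Write $\bar Y_n=\frac1n\sum_{i=1}^nY_i$. The joint density of data and parameter is $\pi(\theta,\boldsymbol{Y}^{(n)})=\theta^{n\bar Y_n}(1-\theta)^{n(1-\bar Y_n)}$ for $\theta\in[0,1]$ (the uniform prior density being $1$ on $[0,1]$). The normalizing constant is $\pi(\boldsymbol{Y}^{(n)})=\int_0^1\pi(\theta,\boldsymbol{Y}^{(n)})\,d\theta$. Let $\hat\theta_n=\operatorname{argmax}_{\theta\in[0,1]}\pi(\theta,\boldsymbol{Y}^{(n)})$ and $\hat H_n=-\frac{d^2}{d\theta^2}\log\pi(\theta,\boldsymbol{Y}^{(n)})\big|_{\theta=\hat\theta_n}$ (well defined whenever $0<\bar Y_n<1$, which holds almost surely for all large enough $n$). The Laplace approximation is $\widetilde\pi_{\mathrm{LA}}(\boldsymbol{Y}^{(n)})=(2\pi)^{1/2}\,\hat H_n^{-1/2}\,\pi(\hat\theta_n,\boldsymbol{Y}^{(n)})$, where the $\pi$ in $(2\pi)^{1/2}$ is the numerical constant. *)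

(* Defs.v *)
From HB Require Import structures.
From mathcomp Require Import all_boot all_order all_algebra finmap.
From mathcomp Require Import all_classical all_reals all_analysis.

Set Implicit Arguments.
Unset Strict Implicit.
Unset Printing Implicit Defensive.

Import Order.TTheory GRing.Theory Num.Theory.
Import numFieldNormedType.Exports.

Local Open Scope classical_set_scope.
Local Open Scope ring_scope.

(* Mutual independence: the product rule on every finite subfamily. *)
Definition mutually_independent d d' (T : measurableType d)
    (T' : measurableType d') (R : realType) (P : probability T R)
    (I : choiceType) (X : I -> {RV P >-> T'}) : Prop :=
  forall (J : {fset I}) (A : I -> set T'),
    (forall i, i \in J -> measurable (A i)) ->
    P (\bigcap_(i in [set` J]) (X i @^-1` A i)) =
    (\prod_(i <- J) P (X i @^-1` A i))%E.

Definition iid_bernoulli d (T : measurableType d) (R : realType)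
    (P : probability T R) (p : R) (Y : nat -> {RV P >-> bool}) : Prop :=
  mutually_independent Y /\
  (forall i, distribution P (Y i) =1 bernoulli_prob p).

(* Indices start at 0: the data (Y_1, ..., Y_n) are Y 0, ..., Y n.-1. *)
Definition sample d (T : measurableType d) (R : realType)
    (P : probability T R) (Y : nat -> {RV P >-> bool}) (n : nat) (w : T)
    : n.-tuple bool := [tuple Y i w | i < n].

Section laplace.
Context {R : realType} {n : nat}.
Implicit Types (y : n.-tuple bool) (t : R).

Definition sample_mean y : R := n%:R^-1 * \sum_(i < n) (tnth y i)%:R.

(* Only meaningful for 0 <= t <= 1, where 0 `^ 0 = 1. *)
Definition joint_density y t : R :=
  t `^ (n%:R * sample_mean y) * (1 - t) `^ (n%:R * (1 - sample_mean y)).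

Lemma joint_densityE y t : 0 <= t <= 1 ->
  joint_density y t =
  uniform_pdf 0 1 t * \prod_(i < n) bernoulli_pmf t (tnth y i).
Proof.
move=> t01; rewrite /uniform_pdf t01 subr0 invr1 mul1r /joint_density.
have [t0 t1] := andP t01; have t1' : 0 <= 1 - t by rewrite subr_ge0.
have nS : n%:R * sample_mean y = (\sum_(i < n) tnth y i)%:R.
  rewrite /sample_mean natr_sum; have [n0|n0] := eqVneq n 0%N.
    by rewrite [X in X%:R * _]n0 mul0r big1// => -[m im] _; have := im; rewrite {1}n0.
  by rewrite mulVKf// pnatr_eq0.
have nC : n%:R * (1 - sample_mean y) = (\sum_(i < n) ~~ tnth y i)%:R.
  rewrite mulrBr mulr1 nS -[X in X%:R - _]card_ord -sum1_card !natr_sum -sumrB.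
  by apply: eq_bigr => i _; case: (tnth y i); rewrite ?subrr ?subr0.
rewrite nS nC !powR_mulrn// !expr_sum -big_split/=.
by apply: eq_bigr => i _; case: (tnth y i); rewrite /= ?mulr1 ?mul1r.
Qed.

Definition normalizing_constant y : R :=
  \int[lebesgue_measure]_(t in `[0, 1]) joint_density y t.

(* The maximizer is unique as soon as 0 < n. *)
Definition theta_hat y : R :=
  [get t : R | t \in `[0, 1] /\
     forall s : R, s \in `[0, 1] -> joint_density y s <= joint_density y t].

(* Meaningful when 0 < sample_mean y < 1, so that theta_hat y is interior. *)
Definition hessian_hat y : R :=
  - derive1n 2 (fun t => ln (joint_density y t)) (theta_hat y).

Definition laplace_approximation y : R :=
  (2 * pi) `^ (1 / 2) * hessian_hat y `^ (- (1 / 2)) *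
  joint_density y (theta_hat y).

End laplace.

(* Main.v *)
From mathcomp Require Import finmap.
Require Import Defs.
From mathcomp Require Import all_boot all_order all_algebra.
From mathcomp Require Import all_classical all_reals all_analysis.
From mathcomp Require Import ring lra.

Import Order.TTheory GRing.Theory Num.Theory.
Import numFieldNormedType.Exports.

Local Open Scope classical_set_scope.
Local Open Scope ring_scope.

(** Let k and m be the numbers of successes and failures among n observations.
    The normalizing constant is the beta integral k! m! / (n+1)!, the density is
    maximal at k/n, and minus the second logarithmic derivative there is
    n^3 / (k m).  Writing s(j) = j! e^j / (sqrt j * j^j), the exact value over
    its Laplace approximation is therefore ([laplace_ratioE])

      n/(n+1) * s(k) s(m) / (s(n) sqrt (2 pi)).

    Stirling's series suggests that this is
    1 + (1/n) (-1 + (n/k + n/m - 1) / 12) + O(1/n^2), and the bracket is negative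
    and bounded away from 0 as long as k/n stays away from 0 and 1.  So the
    ratio is smaller than 1 by a multiple of 1/n, and a good upper bound on it
    suffices.  The bound comes from three facts: s decreases
    ([stirling_ratio_decreasing]); s(j) exp (-1/(12j)) increases
    ([stirling_ratio_le]); and s(N)^2 / s(2N) is at most sqrt (2 pi) up to the
    factor exp (1/(4N)) ([stirling_ratio_sqr_le]), which follows from Wallis'
    integrals.  Together they show that the ratio is at most 1 - 1/(26n) for
    n > 5 as soon as k and m both exceed n/8 ([laplace_ratio_gap]).

    Both outcomes have probability above 1/4.  By Chernoff's bound the
    probability that one of them makes up at most n/8 of the sample decays
    geometrically in n, hence almost surely this happens only finitely often
    ([ae_eventually_many_occurrences]). *)

(** * Rational bounds on the logarithm *)

Section log_bounds.
Context {R : realType}.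
Implicit Types u : R.

Lemma nonneg_of_derive_nonneg (f df : R -> R) : f 0 = 0 ->
  (forall u, 0 <= u -> is_derive u 1 f (df u)) ->
  (forall u, 0 < u -> 0 <= df u) -> forall u, 0 <= u -> 0 <= f u.
Proof.
move=> f0 fdf df0 u u0; rewrite -f0.
apply: (@ger0_derive1_ndecry R f 0) => //.
- by move=> x; rewrite in_itv /= andbT => /ltW x0; have [] := fdf x x0.
- move=> x; rewrite in_itv /= andbT => x0.
  by have [_ dfx] := fdf x (ltW x0); rewrite derive1E dfx df0.
- apply: derivable_within_continuous => x; rewrite in_itv /= andbT => x0.
  by have [] := fdf x x0.
Qed.

Lemma is_derive_quotient (f g : R -> R) (x df dg : R) : g x != 0 ->
  is_derive x 1 f df -> is_derive x 1 g dg ->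
  is_derive x 1 (fun u => f u / g u) ((df * g x - f x * dg) / g x ^+ 2).
Proof.
move=> gx0 fx gx; have gV := is_deriveV gx0 gx.
apply: (is_derive_eq (is_deriveM fx gV)).
by rewrite /GRing.scale /=; field.
Qed.

Lemma is_derive_ln1D (x : R) : 0 <= x -> is_derive x 1 (fun u : R => ln (1 + u)) (1 + x)^-1.
Proof.
move=> x0; have x1 : 0 < 1 + x by lra.
have dln := is_derive1_ln x1.
have d1 : is_derive x 1 (fun u : R => 1 + u) 1.
  by apply: (is_derive_eq (is_deriveD (is_derive_cst _ x 1) (is_derive_id x 1)));
    rewrite add0r.
by apply: (is_derive_eq (is_derive1_comp dln d1)); rewrite mulr1.
Qed.

(** The right-hand side minus the left-hand side vanishes at 0 and has the derivative
    u^2 / ((1+u)(2+u)^2).  At u = 1/n the bound reads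
    (n + 1/2) ln (1 + 1/n) >= 1, which makes Stirling's ratio decrease. *)
Lemma ln1D_lower u : 0 <= u -> 2 * u / (2 + u) <= ln (1 + u).
Proof.
move=> u0; rewrite -subr_ge0.
apply: (@nonneg_of_derive_nonneg (fun u => ln (1 + u) - 2 * u / (2 + u))
  (fun u => u ^+ 2 / ((1 + u) * (2 + u) ^+ 2)) _ _ _ _ u0).
- by rewrite addr0 ln1 mulr0 mul0r subr0.
- move=> x x0.
  have x1 : 1 + x != 0 by rewrite lt0r_neq0 //; lra.
  have x2 : 2 + x != 0 by rewrite lt0r_neq0 //; lra.
  have dn : is_derive x 1 (fun u : R => 2 * u) 2.
    by apply: (is_derive_eq (is_deriveZ 2 (is_derive_id x 1))); rewrite /GRing.scale /= mulr1.
  have dd : is_derive x 1 (fun u : R => 2 + u) 1.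
    by apply: (is_derive_eq (is_deriveD (is_derive_cst _ x 1) (is_derive_id x 1)));
      rewrite add0r.
  have dq := is_derive_quotient _ (fun u : R => 2 + u) _ _ _ x2 dn dd.
  apply: (is_derive_eq (is_deriveB (is_derive_ln1D _ x0) dq)).
  by field; rewrite x1 x2.
- move=> x x0; rewrite divr_ge0 ?mulr_ge0 ?exprn_ge0 //; lra.
Qed.

(** The right-hand side is 2u/(2+u) * (1 + u^2/(12(1+u))); its excess over the
    logarithm vanishes at 0 and has the derivative
    u^4 / (6 (1+u)^2 (2+u)^2).  At u = 1/n the bound reads
    (n + 1/2) ln (1 + 1/n) - 1 <= 1/(12n) - 1/(12(n+1)), whose right-hand side
    telescopes. *)
Lemma ln1D_upper u : 0 <= u ->
  ln (1 + u) <= (12 * u + 12 * u ^+ 2 + u ^+ 3) / (6 * ((1 + u) * (2 + u))).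
Proof.
move=> u0; rewrite -subr_ge0.
apply: (@nonneg_of_derive_nonneg
  (fun u => (12 * u + 12 * u ^+ 2 + u ^+ 3) / (6 * ((1 + u) * (2 + u))) - ln (1 + u))
  (fun u => u ^+ 4 / (6 * ((1 + u) * (2 + u)) ^+ 2)) _ _ _ _ u0).
- by rewrite !addr0 ln1 !expr0n /= !mulr0 !addr0 mul0r subr0.
- move=> x x0.
  have x1 : 1 + x != 0 by rewrite lt0r_neq0 //; lra.
  have x2 : 2 + x != 0 by rewrite lt0r_neq0 //; lra.
  have dn : is_derive x 1 (fun u : R => 12 * u + 12 * u ^+ 2 + u ^+ 3)
      (12 + 24 * x + 3 * x ^+ 2).
    have did := is_derive_id x (1 : R).
    apply: (is_derive_eq (is_deriveD (is_deriveD (is_deriveZ 12 did)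
      (is_deriveZ 12 (is_deriveX 2 did))) (is_deriveX 3 did))).
    by rewrite /GRing.scale /=; ring.
  have dd : is_derive x 1 (fun u : R => 6 * ((1 + u) * (2 + u))) (18 + 12 * x).
    have did := is_derive_id x (1 : R).
    have da a := is_deriveD (is_derive_cst (a : R) x (1 : R)) did.
    apply: (is_derive_eq (is_deriveZ 6 (is_deriveM (da 1) (da 2)))).
    by rewrite /GRing.scale /= !fctE; ring.
  have d0 : 6 * ((1 + x) * (2 + x)) != 0 by rewrite !mulf_neq0.
  have dq := is_derive_quotient _
    (fun u : R => 6 * ((1 + u) * (2 + u))) _ _ _ d0 dn dd.
  apply: (is_derive_eq (is_deriveB dq (is_derive_ln1D _ x0))).
  by field; rewrite x1 x2.
- move=> x x0; rewrite divr_ge0 ?mulr_ge0 ?exprn_ge0 ?mulr_ge0 //; lra.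
Qed.
End log_bounds.

(** * Stirling's ratio *)

Section stirling.
Context {R : realType}.

(** Stirling's formula says that this quantity tends to sqrt (2 pi); it is the
    factorial divided by the main term without that constant. *)
Definition stirling_ratio (n : nat) : R :=
  n`!%:R * expR n%:R / (Num.sqrt n%:R * n%:R ^+ n).

Lemma stirling_ratio_gt0 n : (0 < n)%N -> 0 < stirling_ratio n.
Proof.
move=> n0; have n0' : 0 < n%:R :> R by rewrite ltr0n.
by rewrite /stirling_ratio divr_gt0 ?mulr_gt0 ?expR_gt0 ?sqrtr_gt0 ?exprn_gt0
  ?ltr0n ?fact_gt0.
Qed.

Lemma stirling_ratio_step n : (0 < n)%N ->
  stirling_ratio n =
  stirling_ratio n.+1 * expR ((n%:R + 1 / 2) * ln (1 + n%:R^-1) - 1).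
Proof.
move=> n0; have x0 : 0 < n%:R :> R by rewrite ltr0n.
have x1 : 0 < n.+1%:R :> R by rewrite ltr0n.
have e : 1 + n%:R^-1 = n.+1%:R / n%:R :> R.
  by rewrite -natr1; field; rewrite gt_eqF.
have r0 : 0 < n.+1%:R / n%:R :> R by rewrite divr_gt0.
rewrite e mulrDl expRB expRD.
have -> : expR (n%:R * ln (n.+1%:R / n%:R)) = (n.+1%:R / n%:R) ^+ n :> R.
  by rewrite expRM_natl lnK.
have -> : expR (1 / 2 * ln (n.+1%:R / n%:R)) = Num.sqrt n.+1%:R / Num.sqrt n%:R :> R.
  rewrite mulrC expRM lnK // div1r powR12_sqrt ?ltW //.
  by rewrite sqrtrM 1?ltW // sqrtrV // ltW.
rewrite /stirling_ratio factS natrM expr_div_n exprS -[in expR n.+1%:R]natr1 expRD.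
field.
by rewrite !gt_eqF ?sqrtr_gt0 ?exprn_gt0 ?expR_gt0.
Qed.

Lemma stirling_ratio_decreasing m n : (0 < m <= n)%N ->
  stirling_ratio n <= stirling_ratio m.
Proof.
move=> /andP[m0 mn]; have := mn; rewrite -(subnKC mn); elim: (n - m)%N => [|k IH] _.
  by rewrite addn0.
rewrite addnS; apply: le_trans (IH (leq_addr _ _)).
have k0 : (0 < m + k)%N by rewrite addn_gt0 m0.
rewrite (stirling_ratio_step _ k0) ler_peMr //; first exact/ltW/stirling_ratio_gt0.
have x0 : 0 < (m + k)%:R :> R by rewrite ltr0n.
rewrite -[leLHS]expR0 ler_expR subr_ge0.
have u0 : 0 <= (m + k)%:R^-1 :> R by rewrite invr_ge0 ltW.
apply: le_trans (ler_wpM2l _ (ln1D_lower _ u0)); last lra.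
rewrite le_eqVlt; apply/orP; left; apply/eqP; field.
by rewrite !gt_eqF //; lra.
Qed.

(** The correction 1/(12n) has the sharp constant of Stirling's series.  The
    sharpness matters: when k and m are at least n/8 and add up to n, a
    correction c/k + c/m can be as large as (64/7) c/n, and this has to stay
    below the 1/n that the factor n/(n+1) of the Laplace ratio gains. *)
Lemma stirling_ratio_le m n : (0 < m <= n)%N ->
  stirling_ratio m <= stirling_ratio n * expR (1 / (12 * m%:R) - 1 / (12 * n%:R)).
Proof.
move=> /andP[m0 mn]; have := mn; rewrite -(subnKC mn); elim: (n - m)%N => [|k IH] _.
  by rewrite addn0 subrr expR0 mulr1.
rewrite addnS; apply: (le_trans (IH (leq_addr _ _))).
have k0 : (0 < m + k)%N by rewrite addn_gt0 m0.
rewrite (stirling_ratio_step _ k0) -mulrA ler_pM2l ?stirling_ratio_gt0 //.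
have x0 : 0 < (m + k)%:R :> R by rewrite ltr0n.
rewrite -expRD ler_expR -(natr1 (m + k)).
have u0 : 0 <= (m + k)%:R^-1 :> R by rewrite invr_ge0 ltW.
move: (ln1D_upper _ u0) x0 => {u0}; move: (m + k)%:R => x up x0.
have x12 : 0 <= x + 1 / 2 by lra.
move: (ler_wpM2l x12 up).
have -> : (x + 1 / 2) * ((12 * x^-1 + 12 * x^-1 ^+ 2 + x^-1 ^+ 3) /
    (6 * ((1 + x^-1) * (2 + x^-1)))) = 1 + (1 / (12 * x) - 1 / (12 * (x + 1))).
  by field; rewrite !gt_eqF //; lra.
lra.
Qed.
End stirling.

(** * Wallis' integrals *)

Section wallis.
Context {R : realType}.
Local Notation mu := (@lebesgue_measure R).

Definition wallis_integral (n : nat) : R := \int[mu]_(x in `[0, pi]) (sin x ^+ n).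

Lemma continuous_sinX n : continuous (fun x : R => sin x ^+ n).
Proof.
move=> x; apply: (@continuous_comp _ _ _ sin (fun y => y ^+ n)).
  exact: continuous_sin.
exact: exprn_continuous.
Qed.

Lemma integrable_segment (f : R -> R) (a b : R) : continuous f ->
  mu.-integrable `[a, b] (EFin \o f).
Proof.
move=> cf; apply: continuous_compact_integrable; first exact: segment_compact.
by apply: continuous_in_subspaceT => x _; exact: cf.
Qed.

Lemma wallis_integral_decreasing n : wallis_integral n.+1 <= wallis_integral n.
Proof.
apply: le_Rintegral => //; [exact/integrable_segment/continuous_sinX|exact/integrable_segment/continuous_sinX|].
move=> x; rewrite /= in_itv /= => x0pi.
by rewrite exprS ler_piMl ?exprn_ge0 ?sin_le1 ?sin_ge0_pi.
Qed.

Lemma Rintegral_derive (F f : R -> R) (a b : R) : a < b ->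
  (forall x : R, is_derive x 1 F (f x)) -> continuous f ->
  \int[mu]_(x in `[a, b]) f x = F b - F a.
Proof.
move=> ab dF cf; rewrite /Rintegral (@continuous_FTC2 R f F) //.
- by apply: continuous_in_subspaceT => x _; exact: cf.
- have cF : continuous F.
    by move=> x; apply: differentiable_continuous; apply/derivable1_diffP; case: (dF x).
  split; first by move=> x _; case: (dF x).
  + exact/cvg_at_right_filter/cF.
  + exact/cvg_at_left_filter/cF.
- by move=> x _; rewrite derive1E; case: (dF x).
Qed.

Lemma wallis_integral0 : wallis_integral 0 = pi.
Proof.
rewrite /wallis_integral (@Rintegral_derive id) ?pi_gt0 //; first exact: subr0.
exact: continuous_sinX.
Qed.

Lemma wallis_integral1 : wallis_integral 1 = 2.
Proof.
have dF (x : R) : is_derive x 1 (fun x => - cos x) (sin x ^+ 1).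
  by apply: (is_derive_eq (is_deriveN (is_derive_cos x))); rewrite opprK.
rewrite /wallis_integral (Rintegral_derive _ _ _ _ (pi_gt0 R) dF (continuous_sinX 1)).
by rewrite cospi cos0; ring.
Qed.

(** The primitive - cos x sin x ^ (n+1) of
    (n+2) sin x ^ (n+2) - (n+1) sin x ^ n vanishes at both ends of [0, pi]. *)
Lemma wallis_integral_rec n :
  n.+2%:R * wallis_integral n.+2 = n.+1%:R * wallis_integral n.
Proof.
apply/eqP; rewrite -subr_eq0.
have cD : continuous (fun x : R => n.+2%:R * sin x ^+ n.+2 - n.+1%:R * sin x ^+ n).
  move=> x; apply: cvgB; (apply: cvgM; [exact: cvg_cst|exact: continuous_sinX]).
have dF (x : R) : is_derive x 1 (fun x => - cos x * sin x ^+ n.+1)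
    (n.+2%:R * sin x ^+ n.+2 - n.+1%:R * sin x ^+ n).
  have dsin := is_deriveX n.+1 (is_derive_sin x); rewrite exprfctE in dsin.
  apply: (is_derive_eq (is_deriveM (is_deriveN (is_derive_cos x)) dsin)).
  rewrite /GRing.scale /= !fctE /=.
  have c2 : cos x * cos x = 1 - sin x * sin x by rewrite -!expr2 cos2sin2.
  transitivity (- (cos x * cos x) * n.+1%:R * sin x ^+ n + sin x ^+ n.+1 * sin x); first ring.
  by rewrite c2 -(natr1 n.+1) !exprS; ring.
have := Rintegral_derive _ _ _ _ (pi_gt0 R) dF cD.
rewrite sinpi sin0 !expr0n /= !mulr0 subr0 => <-; apply/eqP.
have cZ (k : R) j : continuous (fun x : R => k * sin x ^+ j).
  by move=> x; apply: cvgM; [exact: cvg_cst|exact: continuous_sinX].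
rewrite RintegralB // ?RintegralZl //; by
  [exact/integrable_segment/continuous_sinX|exact/integrable_segment/cZ].
Qed.

(** By the recurrence the left-hand side does not depend on n. *)
Lemma wallis_integral_mul n :
  n.+1%:R * (wallis_integral n.+1 * wallis_integral n) = 2 * pi.
Proof.
elim: n => [|n IH]; first by rewrite wallis_integral0 wallis_integral1 mul1r.
by rewrite mulrA wallis_integral_rec -mulrA (mulrC (wallis_integral n)).
Qed.

Lemma wallis_integral_odd n :
  wallis_integral n.*2.+1 =
  2 * (4 ^+ n * n`!%:R ^+ 2) / (n.*2.+1)`!%:R.
Proof.
elim: n => [|n IH].
  by rewrite wallis_integral1 expr0 fact0 expr1n !mulr1 divr1.
have /(congr1 (fun z => z / n.*2.+3%:R)) := wallis_integral_rec n.*2.+1.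
rewrite mulrC mulKr ?unitfE ?pnatr_eq0 // doubleS => ->.
have f3 : (n.*2.+3)`!%:R = n.*2.+3%:R * (n.*2.+2%:R * (n.*2.+1)`!%:R) :> R.
  by rewrite factS natrM factS natrM.
have f1 : n.+1`!%:R = n.+1%:R * n`!%:R :> R by rewrite factS natrM.
rewrite IH f3 f1 (exprS 4).
have F0 : (n.*2.+1)`!%:R != 0 :> R by rewrite pnatr_eq0 -lt0n fact_gt0.
have e2 : n.*2.+2%:R = 2 * n.+1%:R :> R by rewrite -natrM -doubleS mul2n.
have e3 : n.*2.+3%:R != 0 :> R by rewrite pnatr_eq0.
have e1 : n.+1%:R != 0 :> R by rewrite pnatr_eq0.
rewrite e2; move: F0 e3 e1.
move: (n.*2.+1)`!%:R n.*2.+3%:R n.+1%:R => F a b F0 a0 b0.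
by field; rewrite F0 a0 b0.
Qed.

(** This is where pi enters: 4^n n!^2 / (2n)! is (2n+1)/2 times the integral
    of sin^(2n+1), and the square of that integral is at most the product of
    two consecutive ones, evaluated by [wallis_integral_mul]. *)
Lemma wallis_bound n :
  (4 ^+ n * n`!%:R ^+ 2 / (n.*2)`!%:R) ^+ 2 <= pi * (n.*2.+1)%:R / 2 :> R.
Proof.
have x0 : 0 < n.*2.+1%:R :> R by rewrite ltr0n.
have F0 : (n.*2)`!%:R != 0 :> R by rewrite pnatr_eq0 -lt0n fact_gt0.
have -> : 4 ^+ n * n`!%:R ^+ 2 / (n.*2)`!%:R =
    n.*2.+1%:R / 2 * wallis_integral n.*2.+1.
  rewrite wallis_integral_odd factS natrM; field.
  by rewrite F0 gt_eqF.
have W0 : 0 <= wallis_integral n.*2.+1.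
  rewrite wallis_integral_odd divr_ge0 ?mulr_ge0 ?exprn_ge0 //.
have := ler_wpM2l W0 (wallis_integral_decreasing n.*2).
move/(ler_wpM2l (mulr_ge0 (ltW x0) (ltW x0))).
have := wallis_integral_mul n.*2.
set w := wallis_integral _; set w' := wallis_integral _; set x : R := _%:R => wx le.
clearbody w w' x.
have -> : pi * x / 2 = x * (x * (w * w')) / 4 by rewrite wx; field.
lra.
Qed.
End wallis.

(** * The constant of Stirling's formula *)

Section central.
Context {R : realType}.
Implicit Types (k m n N : nat).
Local Notation s := (@stirling_ratio R).

Lemma stirling_ratio_sqr N : (0 < N)%N ->
  s N ^+ 2 = s N.*2 * (4 ^+ N * N`!%:R ^+ 2 / (N.*2)`!%:R * 2 / Num.sqrt N.*2%:R).
Proof.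
move=> N0; have x0 : 0 < N%:R :> R by rewrite ltr0n.
have d0 : 0 < Num.sqrt N.*2%:R :> R by rewrite sqrtr_gt0 ltr0n double_gt0.
have d2 : Num.sqrt N.*2%:R ^+ 2 = 2 * N%:R :> R.
  by rewrite sqr_sqrtr ?ler0n // -muln2 natrM mulrC.
have c2 : Num.sqrt N%:R ^+ 2 = N%:R :> R by rewrite sqr_sqrtr ?ler0n.
have F0 : 0 < (N.*2)`!%:R :> R by rewrite ltr0n fact_gt0.
have e2 : expR N.*2%:R = expR N%:R ^+ 2 :> R.
  by rewrite -expRM_natl -natrM mul2n.
have p2 : N.*2%:R ^+ N.*2 = 4 ^+ N * (N%:R ^+ N) ^+ 2 :> R.
  rewrite -[X in X%:R ^+ _]mul2n natrM -mul2n exprM exprMn exprMn.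
  have -> : 4 = 2 * 2 :> R by rewrite -natrM.
  by rewrite [(2 * 2) ^+ N]exprMn; ring.
rewrite /stirling_ratio e2 p2 !exprMn exprVn exprMn c2.
have p0 : 0 < N%:R ^+ N :> R by rewrite exprn_gt0.
have q0 : 0 < 4 ^+ N :> R by rewrite exprn_gt0.
move: p0 q0 d0 d2 F0 x0; move: (N%:R : R) (N%:R ^+ N : R) (4 ^+ N : R)
  (Num.sqrt (N.*2%:R : R)) ((N.*2)`!%:R : R) (N`!%:R : R) (expR N%:R : R)
  => x p q d F f e p0 q0 d0 d2 F0 x0.
have -> : x = d ^+ 2 / 2 by rewrite d2; field.
by field; rewrite !gt_eqF.
Qed.

(** If Stirling's ratio tends to L, the left-hand side tends to L^2 and the
    right-hand side to L sqrt (2 pi), so this says that L <= sqrt (2 pi), in a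
    form that holds for every N. *)
Lemma stirling_ratio_sqr_le N : (0 < N)%N ->
  s N ^+ 2 <= s N.*2 * (Num.sqrt (2 * pi) * expR (1 / (4 * N%:R))).
Proof.
move=> N0; have x0 : 0 < N%:R :> R by rewrite ltr0n.
have := wallis_bound (R := R) N.
rewrite stirling_ratio_sqr // ler_pM2l ?stirling_ratio_gt0 ?double_gt0 //.
have B0 : 0 <= 4 ^+ N * N`!%:R ^+ 2 / (N.*2)`!%:R :> R.
  by rewrite !mulr_ge0 ?invr_ge0 ?exprn_ge0.
move: (_ / _) B0 => B B0 w.
have d0 : 0 < N.*2%:R :> R by rewrite ltr0n double_gt0.
have dE : N.*2%:R = 2 * N%:R :> R by rewrite -muln2 natrM mulrC.
rewrite -ler_sqr ?nnegrE; last 2 first.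
- by rewrite !mulr_ge0 ?invr_ge0 ?sqrtr_ge0.
- by rewrite mulr_ge0 ?sqrtr_ge0 ?expR_ge0.
rewrite [leRHS]exprMn -expRM_natl sqr_sqrtr ?mulr_ge0 ?pi_ge0 //.
rewrite 2!exprMn exprVn sqr_sqrtr ?ler0n //.
have e : 1 + 1 / (2 * N%:R) <= expR (2 * (1 / (4 * N%:R))) :> R.
  apply: le_trans (expR_ge1Dx _); rewrite lerD2l le_eqVlt; apply/orP; left.
  by apply/eqP; field; rewrite gt_eqF.
apply: le_trans (ler_wpM2l _ e); last by rewrite mulr_ge0 ?pi_ge0.
rewrite ler_pdivrMr // -ler_pdivlMr //.
apply: (le_trans w); rewrite -(natr1 N.*2) dE le_eqVlt; apply/orP; left.
by apply/eqP; field; rewrite gt_eqF.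
Qed.

(** The three ratios are compared at the common far index N: the ratios at k
    and m exceed the one at N by factors of at most exp (1/(12k)) and
    exp (1/(12m)),
    the ratio at n is at least the one at 2N, and at N and 2N the constant is
    known up to the factor exp (1/(4N)). *)
Lemma stirling_ratio_mul_le k m n N :
  (0 < k <= N)%N -> (0 < m <= N)%N -> (0 < n <= N.*2)%N ->
  s k * s m <= s n * Num.sqrt (2 * pi) *
    expR (1 / (12 * k%:R) + 1 / (12 * m%:R) + 1 / (4 * N%:R)).
Proof.
move=> /[dup] kN /andP[k0 kN'] mN /[dup] nN /andP[n0 _].
have N0 : (0 < N)%N by rewrite (leq_trans k0).
have sN0 := ltW (stirling_ratio_gt0 (R := R) N N0).
have drop j : (0 < j <= N)%N -> s j <= s N * expR (1 / (12 * j%:R)).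
  move=> jN; apply: (le_trans (stirling_ratio_le _ _ jN)).
  by rewrite ler_wpM2l // ler_expR lerBlDr lerDl divr_ge0 ?mulr_ge0.
have s0 j : (0 < j <= N)%N -> 0 <= s j by move=> /andP[j0 _]; exact/ltW/stirling_ratio_gt0.
apply: (le_trans (ler_pM (s0 _ kN) (s0 _ mN) (drop _ kN) (drop _ mN))).
rewrite mulrACA -expr2 -expRD.
apply: (le_trans (ler_wpM2r (expR_ge0 _) (stirling_ratio_sqr_le N N0))).
rewrite -(mulrA (s N.*2)) -(mulrA (s n)) -(mulrA (Num.sqrt _)) -expRD.
rewrite (addrC (1 / (4 * _))).
apply: ler_wpM2r; first by rewrite mulr_ge0 ?sqrtr_ge0 ?expR_ge0.
exact: stirling_ratio_decreasing.
Qed.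

End central.

(** * The Laplace approximation of the beta integral *)

Section laplace.
Context {R : realType} {n : nat}.
Variable y : n.-tuple bool.

Definition occurrences (b : bool) : nat := (\sum_(i < n) (tnth y i == b))%N.

Local Notation k := (occurrences true).
Local Notation m := (occurrences false).

Lemma occurrences_add : (k + m)%N = n.
Proof.
rewrite -big_split /= -[RHS]card_ord -sum1_card; apply: eq_bigr => i _.
by case: (tnth y i).
Qed.

Lemma sample_mean_occurrences : n%:R * sample_mean y = k%:R :> R.
Proof.
have [n0|n0] := posnP n.
  by rewrite [in n%:R]n0 mul0r; have := occurrences_add; rewrite n0 => /eqP; rewrite addn_eq0 => /andP[/eqP ->].
rewrite /sample_mean mulVKf ?pnatr_eq0 -?lt0n // natr_sum.
by apply: eq_bigr => i _; rewrite eqb_id.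
Qed.

Lemma joint_density_occurrences (t : R) : 0 <= t <= 1 ->
  joint_density y t = t ^+ k * (1 - t) ^+ m.
Proof.
move=> /andP[t0 t1]; rewrite /joint_density mulrBr mulr1 sample_mean_occurrences.
have -> : n%:R - k%:R = m%:R :> R by rewrite -{1}occurrences_add natrD addrC addKr.
by rewrite !powR_mulrn // subr_ge0.
Qed.

Lemma normalizing_constantE :
  normalizing_constant y = (k`! * m`!)%:R / (n.+1)`!%:R :> R.
Proof.
rewrite /normalizing_constant -[in n.+1]occurrences_add -beta_fun_fact.
rewrite /beta_fun -Rintegral_mkcond; apply: eq_Rintegral => t.
by rewrite inE /= in_itv /= => /joint_density_occurrences ->.
Qed.

Hypotheses (k0 : (0 < k)%N) (m0 : (0 < m)%N).

Let kR : 0 < k%:R :> R. Proof. by rewrite ltr0n. Qed.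
Let mR : 0 < m%:R :> R. Proof. by rewrite ltr0n. Qed.
Let nE : n%:R = k%:R + m%:R :> R. Proof. by rewrite -natrD occurrences_add. Qed.
Let nR : 0 < n%:R :> R. Proof. by rewrite nE addr_gt0. Qed.
Let p : R := k%:R / n%:R.
Let p0 : 0 < p. Proof. by rewrite divr_gt0. Qed.
Let q0 : 0 < 1 - p.
Proof. by rewrite subr_gt0 ltr_pdivrMr // mul1r nE ltrDl. Qed.
Let qE : 1 - p = m%:R / n%:R.
Proof. by rewrite /p nE; field; rewrite -nE gt_eqF. Qed.

Let pI : 0 < p < 1. Proof. by rewrite p0 -subr_gt0. Qed.
Let pI' : 0 <= p <= 1. Proof. by case/andP: pI => /ltW -> /ltW. Qed.

(** Each factor is compared with an exponential by x <= exp (x - 1), strictly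
    when x is not 1; at the point p = k/n the exponents k (t/p - 1) and
    m ((1-t)/(1-p) - 1) add up to 0. *)
Lemma joint_density_lt_max (t : R) : 0 <= t <= 1 -> t != p ->
  joint_density y t < joint_density y p.
Proof.
move=> t01 tp; have /andP[t0 t1] := t01.
rewrite !joint_density_occurrences //.
rewrite -[ltRHS]mul1r -ltr_pdivrMr ?mulr_gt0 ?exprn_gt0 //.
have -> : t ^+ k * (1 - t) ^+ m / (p ^+ k * (1 - p) ^+ m) =
    (t / p) ^+ k * ((1 - t) / (1 - p)) ^+ m.
  by rewrite !expr_div_n; field; rewrite !gt_eqF ?exprn_gt0.
have expB (x : R) : x <= expR (x - 1).
  by apply: le_trans (expR_ge1Dx _); rewrite addrC subrK.
have a0 : 0 <= t / p by rewrite divr_ge0 // ltW.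
have b0 : 0 <= (1 - t) / (1 - p) by rewrite divr_ge0 ?(ltW q0) // subr_ge0.
have e1 : 1 = expR (t / p - 1) ^+ k * expR ((1 - t) / (1 - p) - 1) ^+ m :> R.
  rewrite -!expRM_natl -expRD -[LHS]expR0; congr expR.
  rewrite qE /p nE; field.
  by rewrite -nE !gt_eqF.
rewrite [ltRHS]e1.
apply: (@le_lt_trans _ _ ((t / p) ^+ k * expR ((1 - t) / (1 - p) - 1) ^+ m)).
  by rewrite ler_wpM2l ?exprn_ge0 // lerXn2r ?nnegrE // ltW // expR_gt0.
rewrite ltr_pM2r ?exprn_gt0 ?expR_gt0 // ltr_pXn2r ?nnegrE ?expR_ge0 //.
have h : t / p - 1 != 0.
  rewrite subr_eq0; apply: contra tp => /eqP h.
  by rewrite -[p]mul1r -h divfK // gt_eqF.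
by have := expR_gt1Dx h; rewrite addrC subrK.
Qed.

Lemma theta_hatE : theta_hat y = p.
Proof.
have pI2 : p \in `[0, 1] by rewrite in_itv.
rewrite /theta_hat; apply: get_unique => [|t] /=.
  split => // s; have [->//|sp] := eqVneq s p.
  by rewrite in_itv /= => s01; rewrite ltW // joint_density_lt_max.
move=> [tI tmax]; apply/eqP; apply: contraT => tp.
by have := tmax p pI2; rewrite leNgt joint_density_lt_max.
Qed.

Let ln_joint (t : R) : 0 < t < 1 ->
  ln (joint_density y t) = k%:R * ln t + m%:R * ln (1 - t).
Proof.
move=> /andP[t0 t1]; have t1' : 0 < 1 - t by rewrite subr_gt0.
rewrite joint_density_occurrences ?ltW // lnM ?posrE ?exprn_gt0 // !lnXn //.
by rewrite !mulr_natl.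
Qed.

Lemma hessian_hatE : hessian_hat y = n%:R ^+ 3 / (k%:R * m%:R) :> R.
Proof.
rewrite /hessian_hat theta_hatE /derive1n /=.
(* The explicit formulas hold only on ]0, 1[, so each derivative is computed
   through the germ of the function at an interior point. *)
have near01 (t : R) (f g : R -> R) : 0 < t < 1 ->
    (forall s, 0 < s < 1 -> f s = g s) -> \near t, f t = g t.
  move=> t01 fg; have tI : t \in `]0, 1[ by rewrite in_itv.
  by near=> s; apply: fg; near: s; apply: filterS (near_in_itvoo tI) => s; rewrite in_itv.
have did t := is_derive_id t (1 : R).
have d1m (t : R) : is_derive t 1 (fun t : R => 1 - t) (-1).
  by apply: (is_derive_eq (is_deriveB (is_derive_cst (1 : R) t (1 : R)) (did t))); rewrite sub0r.
have d1 (t : R) : 0 < t < 1 ->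
    derive1 (fun t => ln (joint_density y t)) t = k%:R / t - m%:R / (1 - t).
  move=> t01; have /andP[t0 t1] := t01; rewrite derive1E.
  rewrite (near_eq_derive _ (near01 _ _ _ t01 ln_joint)).
  have t1' : 0 < 1 - t by rewrite subr_gt0.
  have := is_deriveD (is_deriveZ k%:R (is_derive1_ln t0))
    (is_deriveZ m%:R (@is_derive1_comp _ _ (fun s => 1 - s) _ _ _ (is_derive1_ln t1') (d1m t))).
  by move=> [_ ->]; rewrite /GRing.scale /= mulrN1 mulrN.
rewrite derive1E (near_eq_derive _ (near01 _ _ _ pI d1)).
have pn0 : p != 0 by rewrite gt_eqF.
have qn0 : 1 - p != 0 by rewrite gt_eqF.
have := is_deriveB (is_deriveZ k%:R (@is_deriveV _ id _ _ _ pn0 (did p)))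
  (is_deriveZ m%:R (@is_deriveV _ (fun t => 1 - t) _ _ _ qn0 (d1m p))).
move=> [_ ->]; rewrite /GRing.scale /= qE /p nE; field.
by rewrite -nE !gt_eqF.
Unshelve. all: by end_near. Qed.

Lemma laplace_approximationE :
  laplace_approximation y =
  Num.sqrt (2 * pi) * Num.sqrt (k%:R * m%:R / n%:R ^+ 3) *
  (k%:R ^+ k * m%:R ^+ m / n%:R ^+ n) :> R.
Proof.
rewrite /laplace_approximation hessian_hatE theta_hatE joint_density_occurrences //.
have H0 : 0 <= n%:R ^+ 3 / (k%:R * m%:R) :> R.
  by rewrite divr_ge0 ?exprn_ge0 ?mulr_ge0 // ltW.
rewrite powRN !div1r !powR12_sqrt // ?mulr_ge0 ?pi_ge0 //.
rewrite -sqrtrV // invf_div; congr (_ * _).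
have -> : n%:R ^+ n = n%:R ^+ k * n%:R ^+ m :> R by rewrite -exprD occurrences_add.
rewrite qE /p !expr_div_n.
by field; rewrite !expf_neq0 // gt_eqF.
Qed.
End laplace.

Section ratio.
Context {R : realType} {n : nat}.
Variable y : n.-tuple bool.
Local Notation k := (occurrences y true).
Local Notation m := (occurrences y false).
Local Notation s := (@stirling_ratio R).

(** Writing each factorial as its Stirling ratio times the main term, the powers
    and exponentials cancel; the factor n/(n+1) comes from (n+1)!. *)
Lemma laplace_ratioE : (0 < k)%N -> (0 < m)%N ->
  normalizing_constant y / laplace_approximation y =
  n%:R / n.+1%:R * (s k * s m / (s n * Num.sqrt (2 * pi))) :> R.
Proof.
move=> k0 m0; rewrite normalizing_constantE laplace_approximationE //.
have kR : 0 < k%:R :> R by rewrite ltr0n.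
have mR : 0 < m%:R :> R by rewrite ltr0n.
have nE : n%:R = k%:R + m%:R :> R by rewrite -natrD occurrences_add.
have nR : 0 < n%:R :> R by rewrite nE addr_gt0.
have eE : expR n%:R = expR k%:R * expR m%:R :> R by rewrite nE expRD.
have sqE : Num.sqrt (k%:R * m%:R / n%:R ^+ 3) =
    Num.sqrt k%:R * Num.sqrt m%:R / (n%:R * Num.sqrt n%:R) :> R.
  have -> : n%:R * Num.sqrt n%:R = Num.sqrt (n%:R ^+ 3) :> R.
    by rewrite exprSr sqrtrM ?exprn_ge0 ?ler0n // sqrtr_sqr ger0_norm ?ler0n.
  by rewrite sqrtrM ?mulr_ge0 ?ler0n // sqrtrM ?ler0n // sqrtrV ?exprn_ge0 ?ler0n.
rewrite sqE /stirling_ratio eE factS !natrM.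
have sp : 0 < Num.sqrt (2 * pi) :> R by rewrite sqrtr_gt0 mulr_gt0 ?pi_gt0.
have sk : 0 < Num.sqrt k%:R :> R by rewrite sqrtr_gt0.
have sm : 0 < Num.sqrt m%:R :> R by rewrite sqrtr_gt0.
have sn : 0 < Num.sqrt n%:R :> R by rewrite sqrtr_gt0.
have kk : 0 < k%:R ^+ k :> R by rewrite exprn_gt0.
have mm : 0 < m%:R ^+ m :> R by rewrite exprn_gt0.
have nn : 0 < n%:R ^+ n :> R by rewrite exprn_gt0.
have ek := expR_gt0 (k%:R : R).
have em := expR_gt0 (m%:R : R).
have nf : 0 < n`!%:R :> R by rewrite ltr0n fact_gt0.
have n1 : 0 < n.+1%:R :> R by rewrite ltr0n.
by field; rewrite !gt_eqF.
Qed.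

(** With both counts above n/8 one has k m >= 7n^2/64, so the corrections
    1/(12k) + 1/(12m) = n/(12km) are at most 16/(21n).  This is less than the
    loss of about 1/n in the factor n/(n+1), so the ratio stays below 1 by a
    fixed multiple of 1/n. *)
Lemma laplace_ratio_gap : (5 < n)%N -> (n < 8 * k)%N -> (n < 8 * m)%N ->
  1 / (26 * n%:R) <=
  `| normalizing_constant y / laplace_approximation y - 1 | :> R.
Proof.
move=> n5 nk nm.
have k0 : (0 < k)%N by case: (k) nk.
have m0 : (0 < m)%N by case: (m) nm.
have kR : n%:R < 8 * k%:R :> R by rewrite -natrM ltr_nat.
have mR : n%:R < 8 * m%:R :> R by rewrite -natrM ltr_nat.
have nE : n%:R = k%:R + m%:R :> R by rewrite -natrD occurrences_add.
have n5R : 5 < n%:R :> R by rewrite ltr_nat.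
have n0 : (0 < n)%N by rewrite (leq_trans _ n5).
have kn : (k <= n)%N by rewrite -[leqRHS](occurrences_add y) leq_addr.
have mn : (m <= n)%N by rewrite -[leqRHS](occurrences_add y) leq_addl.
have n8 : (n <= 8 * n)%N by rewrite leq_pmull.
(* The index N = 8n makes the remaining error 1/(4N) equal to 1/(32n), so that
   the total exponent is below 4/(5n), as 16/21 + 1/32 < 4/5. *)
have le1 : s k * s m / (s n * Num.sqrt (2 * pi)) <=
    expR (1 / (12 * k%:R) + 1 / (12 * m%:R) + 1 / (4 * (8 * n)%:R)).
  rewrite ler_pdivrMr; last first.
    apply: mulr_gt0; first exact: stirling_ratio_gt0.
    by rewrite sqrtr_gt0 mulr_gt0 ?pi_gt0.
  rewrite [leRHS]mulrC; apply: stirling_ratio_mul_le.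
  - by rewrite k0 (leq_trans kn).
  - by rewrite m0 (leq_trans mn).
  - by rewrite n0 (leq_trans n8) // -addnn leq_addr.
have nx0 : 0 < n%:R :> R by lra.
have kx0 : 0 < k%:R :> R by lra.
have mx0 : 0 < m%:R :> R by lra.
have le2 : 1 / (12 * k%:R) + 1 / (12 * m%:R) + 1 / (4 * (8 * n)%:R) <= 4 / (5 * n%:R) :> R.
  have -> : 1 / (12 * k%:R) + 1 / (12 * m%:R) + 1 / (4 * (8 * n)%:R) =
      n%:R / (12 * (k%:R * m%:R)) + 1 / (32 * n%:R) :> R.
    by rewrite natrM [in n%:R / _]nE; field; rewrite !gt_eqF.
  have km : 7 * n%:R ^+ 2 <= 64 * (k%:R * m%:R) :> R by nra.
  have : n%:R / (12 * (k%:R * m%:R)) <= 16 / (21 * n%:R) :> R.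
    rewrite ler_pdivrMr ?mulr_gt0 // mulrAC ler_pdivlMr ?mulr_gt0 //; nra.
  have -> : 4 / (5 * n%:R) = 16 / (21 * n%:R) + (4 / 5 - 16 / 21) * n%:R^-1 :> R.
    by field; rewrite gt_eqF.
  have -> : 1 / (32 * n%:R) = 1 / 32 * n%:R^-1 :> R by field; rewrite gt_eqF.
  have : 0 < n%:R^-1 :> R by rewrite invr_gt0.
  lra.
have le3 : expR (4 / (5 * n%:R)) <= n%:R / (n%:R - 4 / 5) :> R.
  rewrite -[leLHS]invrK -expRN -[leRHS]invf_div lef_pV2 ?posrE ?expR_gt0 ?divr_gt0 //; last lra.
  apply: le_trans (expR_ge1Dx _); rewrite le_eqVlt; apply/orP; left.
  by apply/eqP; field; rewrite gt_eqF.
have le4 : n%:R / n.+1%:R * (n%:R / (n%:R - 4 / 5)) <= 1 - 1 / (26 * n%:R) :> R.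
  rewrite -natr1 mulf_div ler_pdivrMr; last by rewrite mulr_gt0 //; lra.
  have -> : 1 - 1 / (26 * n%:R) = (26 * n%:R - 1) / (26 * n%:R) :> R.
    by field; rewrite gt_eqF.
  rewrite mulrAC ler_pdivlMr ?mulr_gt0 //; nra.
have le5 : normalizing_constant y / laplace_approximation y <= 1 - 1 / (26 * n%:R) :> R.
  rewrite laplace_ratioE //; apply: le_trans le4.
  apply: ler_wpM2l; first exact: divr_ge0.
  apply: (le_trans le1); apply: le_trans le3.
  by rewrite ler_expR.
rewrite distrC; apply: le_trans (ler_norm _); lra.
Qed.
End ratio.

(** * Observed frequencies *)

(** Borel and Cantelli, with a geometric series as the dominating one. *)
Lemma ae_eventually_notin_of_geometric d (T : measurableType d) (R : realType)
    (P : {measure set T -> \bar R}) (F : (set T)^nat) (r : R) :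
  0 <= r < 1 -> (forall n, measurable (F n)) ->
  (forall n, (P (F n) <= (r ^+ n)%:E)%E) ->
  {ae P, forall w, exists N0 : nat, forall n : nat, (N0 < n)%N -> ~ F n w}.
Proof.
move=> /andP[r0 r1] mF PF.
exists (lim_sup_set F); split.
- by apply: bigcapT_measurable => k; apply: bigcup_measurable.
- apply: lim_sup_set_cvg0 => //.
  apply: (@le_lt_trans _ _ (\sum_(0 <= n <oo) (r ^+ n)%:E)%E).
    by apply: lee_nneseries.
  have cvgr : series (geometric 1 r) x @[x --> \oo] --> 1 / (1 - r).
    by apply: cvg_geometric_series; rewrite ger0_norm.
  have -> : (\sum_(0 <= n <oo) (r ^+ n)%:E)%E = (1 / (1 - r))%:E.
    apply/cvg_lim => //.
    rewrite [X in X x @[x --> _]](_ : _ = EFin \o series (geometric 1 r)).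
      by apply: cvg_EFin => //; apply: nearW.
    apply/funext => n /=; rewrite sumEFin; congr (_%:E).
    by apply: eq_bigr => i _; rewrite /geometric /= mul1r.
  exact: ltry.
- move=> w /= nex n _; apply: contrapT => h; apply: nex; exists n => k nk Fk.
  by apply: h; exists k => //=; exact: ltnW.
Qed.

Section bernoulli_sampling.
Context d (T : measurableType d) (R : realType) (P : probability T R).
Variables (p : R) (Y : nat -> {RV P >-> bool}).
Hypothesis p01 : 0 <= p <= 1.
Hypothesis Yiid : iid_bernoulli p Y.

Lemma iid_bernoulli_cylinder n (f : {ffun 'I_n -> bool}) :
  let C := [set w | forall i : 'I_n, Y i w = f i] in
  measurable C /\ P C = (\prod_(i < n) bernoulli_pmf p (f i))%:E.
Proof.
move=> C; have [Yind Ydist] := Yiid.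
(* Independence speaks of families indexed by nat: f is extended by false. *)
pose g (i : nat) : set bool := [set if insub i is Some j then f j else false].
have [J JE Jiota] : exists2 J : {fset nat},
    J =i iota 0 n & perm_eq J (iota 0 n).
  exists (seq_fset tt (iota 0 n)); first exact: seq_fsetE.
  by rewrite (perm_trans (seq_fset_perm _ _)) // undup_id ?iota_uniq.
have CE : C = \bigcap_(i in [set` J]) (Y i @^-1` g i).
  apply/seteqP; split => w.
    move=> Cw i /=; rewrite JE mem_iota /= add0n => ilt.
    by rewrite /g /= insubT (Cw (Ordinal ilt)).
  move=> h i; have := h i; rewrite /= JE mem_iota /= add0n => /(_ (ltn_ord i)).
  by rewrite /g /= valK.
have PY i : P (Y i @^-1` g i) = (bernoulli_pmf p (if insub i is Some j then f j else false))%:E.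
  have := Ydist i (g i); rewrite /distribution /pushforward /= => ->.
  by rewrite /bernoulli_prob p01 fsbig_set1.
split.
  rewrite CE; apply: fin_bigcap_measurable => //.
  by move=> i _; rewrite -[_ @^-1` _]setTI; exact: measurable_funPT.
rewrite CE Yind // (perm_big _ Jiota) /=.
under eq_bigr do rewrite PY.
rewrite -[X in iota _ X]subn0 big_mkord.
rewrite prodEFin; congr (_%:E).
by apply: eq_bigr => i _; rewrite valK.
Qed.

(** Chernoff's bound: on the event, 1 <= s ^ (8 * occurrences - n).  The
    expectation of this power is a sum over all words of length n, which
    factors into the n-th power of a sum over the two letters. *)
Lemma few_occurrences_bound n (b : bool) (s : R) : 0 < s <= 1 ->
  let F := [set w | (8 * \sum_(i < n) (Y i w == b) <= n)%N] in
  measurable F /\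
  (P F <= (((1 - bernoulli_pmf p b * (1 - s ^+ 8)) / s) ^+ n)%:E)%E.
Proof.
move=> /andP[s0 s1] F.
pose A (f : {ffun 'I_n -> bool}) := (8 * \sum_(i < n) (f i == b) <= n)%N.
pose C (f : {ffun 'I_n -> bool}) := [set w | forall i : 'I_n, Y i w = f i].
have mC f : measurable (C f) := (iid_bernoulli_cylinder n f).1.
have PC f : P (C f) = (\prod_(i < n) bernoulli_pmf p (f i))%:E :=
  (iid_bernoulli_cylinder n f).2.
have FE : F = \big[setU/set0]_(f | A f) C f.
  rewrite -bigcup_seq_cond; apply/seteqP; split => w /=.
    move=> Fw; exists [ffun i : 'I_n => Y i w]; last by move=> i; rewrite ffunE.
    rewrite /= mem_index_enum /= /A.
    by under eq_bigr do rewrite ffunE.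
  move=> [f /= /andP[_ Af] Cf].
  by rewrite /F /=; under eq_bigr do rewrite Cf.
have mF : measurable F by rewrite FE; exact: bigsetU_measurable.
split => //.
have pmf0 c : 0 <= bernoulli_pmf p c by exact: bernoulli_pmf_ge0.
have step : (P F <= \sum_(f | A f) P (C f))%E.
  suff : measurable (\big[setU/set0]_(f | A f) C f) /\
      (P (\big[setU/set0]_(f | A f) C f) <= \sum_(f | A f) P (C f))%E.
    by rewrite FE => -[].
  elim/big_rec2 : _ => [|f x B _ [mB PB]]; first by rewrite measure0.
  split; first exact: measurableU.
  by rewrite (le_trans (measureU2 _ (mC f) mB)) // leeD2l.
apply: (le_trans step).
under eq_bigr do rewrite PC.
rewrite sumEFin lee_fin.
pose G (c : bool) := bernoulli_pmf p c * s ^+ (8 * (c == b)) / s.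
have G0 c : 0 <= G c by rewrite /G divr_ge0 ?mulr_ge0 ?exprn_ge0 // ltW.
have -> : (1 - bernoulli_pmf p b * (1 - s ^+ 8)) / s = \sum_c G c.
  rewrite big_bool /G /bernoulli_pmf; case: (b) => /=;
    rewrite ?muln0 ?muln1 ?expr0; field; exact: lt0r_neq0.
rewrite -[X in _ ^+ X]card_ord -prodr_const bigA_distr_bigA /=.
apply: (@le_trans _ _ (\sum_(f | A f) \prod_i G (f i))); last first.
  rewrite [leRHS](bigID A) /= lerDl; apply: sumr_ge0 => f _.
  by apply: prodr_ge0 => i _.
apply: ler_sum => f Af.
rewrite /G !big_split /= prodr_const card_ord -expr_sum -big_distrr /=.
rewrite -mulrA ler_peMr ?prodr_ge0 // exprVn ler_pdivlMr ?exprn_gt0 // mul1r.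
by rewrite ler_wiXn2l // ltW.
Qed.

(** For a letter of probability at least 1/4, the base of Chernoff's bound at
    s = 9/10 is at most (1 - (1 - s^8)/4) / s < 0.96. *)
Lemma ae_eventually_many_occurrences (b : bool) : 1 / 4 <= bernoulli_pmf p b ->
  {ae P, forall w, exists N0 : nat, forall n : nat, (N0 < n)%N ->
    (n < 8 * \sum_(i < n) (Y i w == b))%N}.
Proof.
move=> pb.
have s01 : 0 < (9 / 10 : R) <= 1 by apply/andP; split; lra.
pose F n := [set w | (8 * \sum_(i < n) (Y i w == b) <= n)%N].
set q := bernoulli_pmf p b in pb.
have q1 : q <= 1.
  by move: p01 => /andP[? ?]; rewrite /q /bernoulli_pmf; case: (b); lra.
have r01 : 0 <= (1 - q * (1 - (9 / 10) ^+ 8)) / (9 / 10) < 1 by lra.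
have := @ae_eventually_notin_of_geometric _ _ _ P F _ r01
  (fun n => (few_occurrences_bound n b _ s01).1)
  (fun n => (few_occurrences_bound n b _ s01).2).
apply: filterS => w [N0 h]; exists N0 => n nN0.
by rewrite ltnNge; apply/negP => /(h n nN0).
Qed.

End bernoulli_sampling.

Theorem theorem3p2 (R : realType) (d : measure_display) (T : measurableType d)
    (P : probability T R) (theta : R) (Y : nat -> {RV P >-> bool}) :
  1 / 4 < theta < 3 / 4 ->
  iid_bernoulli theta Y ->
  {ae P, forall w, exists N0 : nat, forall n : nat, (N0 < n)%N ->
    1 / (26 * n%:R) <=
    `| normalizing_constant (sample Y n w) /
       laplace_approximation (sample Y n w) - 1 | :> R}.
Proof.
move=> /andP[theta_gt theta_lt] Yiid.
have theta01 : 0 <= theta <= 1 by lra.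
have often b : 1 / 4 <= bernoulli_pmf theta b by case: b => /=; lra.
have := ae_eventually_many_occurrences _ _ _ _ _ Y theta01 Yiid true (often true).
have := ae_eventually_many_occurrences _ _ _ _ _ Y theta01 Yiid false (often false).
apply: filterS2 => w [N1 h1] [N2 h2].
exists (maxn 5 (maxn N1 N2)) => n; rewrite !gtn_max => /and3P[n5 n1 n2].
have occE b : occurrences (sample Y n w) b = (\sum_(i < n) (Y i w == b))%N.
  by rewrite /occurrences; apply: eq_bigr => i _; rewrite tnth_mktuple.
by apply: laplace_ratio_gap => //; rewrite occE; [exact: h2|exact: h1].
Qed.
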